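(* Let $n\ge1$. For $0\le\theta_1\le\cdots\le\theta_n\le\pi$ put $$p(x)=\prod_{j=1}^n(x-\cos\theta_j),\qquad f(x)=\sqrt{1-x}\;p(x),$$ $$M(\cos\theta_1,\ldots,\cos\theta_n)=\sqrt{\prod_{j=1}^n(1-\cos\theta_j)}\;\prod_{1\le j<k\le n}|\cos\theta_j-\cos\theta_k|.$$ If $(\theta_1,\ldots,\theta_n)$ is a point at which $M$ attains its maximum over all $0\le\theta_1\le\cdots\le\theta_n\le\pi$, then $f$ satisfies the ordinary differential equation $$f''(x)=\frac{-n^2}{1-x^2}\cdot\frac{1-x+\frac{1}{4n^2}(1+x)}{1-x}\,f(x)$$ for $x\in(-1,1)$.
   Context: The product $\prod_{j<k}|\cos\theta_j-\cos\theta_k|$ is the nonnegative square root of the discriminant of $p$. (Up to a constant factor, $M^2$ is the volume of the conjugacy class in $SO(2n+1)$ with rotation angles $\theta_1,\ldots,\theta_n$.) *)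

(* Defs.v *)
From HB Require Import structures.
From mathcomp Require Import all_boot all_order all_algebra.
From mathcomp Require Import classical_sets reals topology normedtype derive trigo.

Set Implicit Arguments.
Unset Strict Implicit.
Unset Printing Implicit Defensive.

Import Order.TTheory GRing.Theory Num.Theory.
Import numFieldNormedType.Exports.

Local Open Scope ring_scope.

(* An ordinal j : 'I_n stands for the index j + 1 in {1, ..., n}. *)
Definition ordered_angles (R : realType) (n : nat) (theta : 'I_n -> R) : Prop :=
  (forall j, 0 <= theta j <= pi) /\
  (forall j k : 'I_n, (j <= k)%N -> theta j <= theta k).

Definition M (R : realType) (n : nat) (x : 'I_n -> R) : R :=
  Num.sqrt (\prod_(j < n) (1 - x j)) *
  \prod_(j < n) \prod_(k < n | (j < k)%N) `|x j - x k|.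

Definition maximizes_M (R : realType) (n : nat) (theta : 'I_n -> R) : Prop :=
  ordered_angles theta /\
  forall phi : 'I_n -> R, ordered_angles phi ->
    M (fun j => cos (phi j)) <= M (fun j => cos (theta j)).

Definition p (R : realType) (n : nat) (theta : 'I_n -> R) : {poly R} :=
  \prod_(j < n) ('X - (cos (theta j))%:P).

(* Num.sqrt is 0 on negative reals; only 1 - x >= 0 matters here. *)
Definition f (R : realType) (n : nat) (theta : 'I_n -> R) (x : R) : R :=
  Num.sqrt (1 - x) * (p theta).[x].

(* Main.v *)
(** As a function of [t = cos theta_i] alone, [M^2] is a positive constant times
    [h(t) = (1 - t) q(t)^2] with [q = p / (X - cos theta_i)].  For the smallest
    cosine the maximum of [h] is at the endpoint [-1]; for every other one it is
    interior, and [h' = 0] there says [(1 - X) p'' = p'] at that root of [p].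
    Hence [(1 + X) ((1 - X) p'' - p') + n^2 p] vanishes at the [n] distinct roots
    of [p]; its coefficient of degree [n] cancels, so it is zero, and this
    identity is the differential equation for [f = sqrt (1 - x) p]. *)

Require Import Defs.
From HB Require Import structures.
From mathcomp Require Import all_boot all_order all_algebra ring.
From mathcomp Require Import boolp functions classical_sets reals topology normedtype.
From mathcomp Require Import derive trigo realfun.

Set Implicit Arguments.
Unset Strict Implicit.
Unset Printing Implicit Defensive.

Import Order.TTheory GRing.Theory Num.Theory.
Import numFieldNormedType.Exports.

Local Open Scope ring_scope.

(** * Dependence of [M] on a single variable *)

Lemma prod_pairsD1 (A : comPzRingType) (n : nat) (F : 'I_n -> 'I_n -> A)
    (i : 'I_n) : (forall j k, F j k = F k j) ->
  \prod_(j < n) \prod_(k < n | (j < k)%N) F j k =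
  \prod_(k < n | k != i) F i k *
  \prod_(j < n | j != i) \prod_(k < n | (j < k)%N && (k != i)) F j k.
Proof.
move=> Fsym; rewrite (bigD1 i)//=.
under [X in _ * X]eq_bigr => j ji do rewrite (bigID (pred1 i))/=.
rewrite big_split/= mulrA; congr (_ * _).
(* Pairs containing [i] come in two kinds: [i] is the smaller index, or it is the larger one and
   symmetry of [F] swaps the arguments. *)
rewrite [RHS](bigID (fun k : 'I_n => (i < k)%N))/=; congr (_ * _).
  by apply: eq_bigl => k; rewrite andb_idl// => /ltn_eqF; rewrite eq_sym => /negbT.
rewrite [LHS](bigID (fun j : 'I_n => (i < j)%N))/= big1 ?mul1r.
  apply: eq_bigr => j /andP[ji]; rewrite -leqNgt leq_eqVlt => /orP[/eqP/val_inj e|lt].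
    by rewrite e eqxx in ji.
  rewrite (bigD1 i) ?lt ?eqxx//= big1 ?mulr1// => k /andP[/andP[_ ->]]//.
move=> j /andP[ji ij]; rewrite big_pred0// => k.
by apply/negP => /andP[+ /eqP e]; rewrite e ltnNge ltnW.
Qed.

(* Up to a factor independent of [x i], this is [M x ^ 2] as a polynomial in [x i]. *)
Definition M2_section (R : realType) n (x : 'I_n -> R) (i : 'I_n) : {poly R} :=
  (1 - 'X) * (\prod_(k < n | k != i) ('X - (x k)%:P)) ^+ 2.

Section M_section.
Variables (R : realType) (n : nat).
Implicit Types (x y : 'I_n -> R) (i : 'I_n).

Lemma hornerM2_section x i t :
  (M2_section x i).[t] = (1 - t) * \prod_(k < n | k != i) (t - x k) ^+ 2.
Proof.
rewrite hornerM hornerD hornerN hornerX hornerC horner_exp horner_prod -prodrXl.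
by congr (_ * _); apply: eq_bigr => k _; rewrite hornerXsubC.
Qed.

Let cofactor_M2 x i : R := \prod_(k < n | k != i) (1 - x k) *
  \prod_(j < n | j != i) \prod_(k < n | (j < k)%N && (k != i)) (x j - x k) ^+ 2.

Let M_sqrE x i : (forall j, x j <= 1) ->
  M x ^+ 2 = cofactor_M2 x i * (M2_section x i).[x i].
Proof.
move=> x1; rewrite /M exprMn sqr_sqrtr; last first.
  by apply: prodr_ge0 => j _; rewrite subr_ge0.
have -> : (\prod_(j < n) \prod_(k < n | (j < k)%N) `|x j - x k|) ^+ 2 =
    \prod_(j < n) \prod_(k < n | (j < k)%N) (x j - x k) ^+ 2.
  rewrite -prodrXl; apply: eq_bigr => j _; rewrite -prodrXl.
  by apply: eq_bigr => k _; rewrite real_normK ?num_real.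
rewrite (@prod_pairsD1 _ _ _ i) => [|j k]; last by rewrite -sqrrN opprB.
by rewrite (bigD1 i)//= /cofactor_M2 hornerM2_section; ring.
Qed.

(** Points that agree off [i] share the cofactor of the section in [M ^ 2]. It is positive because
    [M x] is, so it cancels from [M y ^ 2 <= M x ^ 2]. *)
Lemma M2_section_le x y i : (forall j, x j <= 1) -> (forall j, y j <= 1) ->
  (forall k, k != i -> y k = x k) -> 0 < M x -> M y <= M x ->
  (M2_section x i).[y i] <= (M2_section x i).[x i].
Proof.
move=> x1 y1 yx Mx Myx.
have cE : cofactor_M2 y i = cofactor_M2 x i.
  rewrite /cofactor_M2; congr (_ * _).
    by apply: eq_bigr => k ki; rewrite yx.
  apply: eq_bigr => j ji; apply: eq_bigr => k /andP[_ ki].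
  by rewrite !yx.
have sE : M2_section y i = M2_section x i.
  by congr (_ * _ ^+ 2); apply: eq_bigr => k ki; rewrite yx.
have c0 : 0 < cofactor_M2 x i.
  rewrite lt_neqAle mulr_ge0 ?andbT.
  - apply/eqP => c0; move: (M_sqrE i x1); rewrite -c0 mul0r => /eqP.
    by rewrite sqrf_eq0 gt_eqF.
  - by apply: prodr_ge0 => k _; rewrite subr_ge0.
  - by apply: prodr_ge0 => j _; apply: prodr_ge0 => k _; rewrite sqr_ge0.
have My0 : 0 <= M y.
  by rewrite mulr_ge0 ?sqrtr_ge0// prodr_ge0// => j _; rewrite prodr_ge0.
rewrite -(ler_pM2l c0) -M_sqrE// -{1}cE -sE -M_sqrE//.
by rewrite ler_pXn2r// ?nnegrE// ltW.
Qed.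

Lemma M_gt0P x : (forall j, x j <= 1) ->
  reflect (injective x /\ forall j, x j < 1) (0 < M x).
Proof.
move=> x1; apply: (iffP idP) => [Mx|[xinj xlt1]]; last first.
  rewrite mulr_gt0//; first by rewrite sqrtr_gt0 prodr_gt0// => j _; rewrite subr_gt0.
  apply: prodr_gt0 => j _; apply: prodr_gt0 => k jk; rewrite normr_gt0 subr_eq0.
  by apply: contraTneq jk => /xinj ->; rewrite ltnn.
have xneq (j k : 'I_n) : (j < k)%N -> x j != x k.
  move=> jk; apply: contraTneq Mx => e.
  rewrite /M [X in _ * X](bigD1 j)//= [X in _ * (X * _)](bigD1 k)//= e.
  by rewrite subrr normr0 !mul0r mulr0 ltxx.
split=> [j k e|j].
  by apply/val_inj; case: (ltngtP j k) => // /xneq; rewrite e eqxx.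
rewrite lt_neqAle x1 andbT; apply: contraTneq Mx => e.
by rewrite /M (bigD1 j)//= e subrr mul0r sqrtr0 mul0r ltxx.
Qed.

End M_section.

(** * Angles at a maximum of [M] *)

Section maximizer.
Variables (R : realType) (n : nat) (theta : 'I_n -> R).
Hypothesis theta_max : maximizes_M theta.
Let x := fun j => cos (theta j).

Let theta_in j : theta j \in `[0, pi].
Proof. by rewrite in_itv/=; case: theta_max => -[]. Qed.

Let cos_le (y : 'I_n -> R) j : (fun j => cos (y j)) j <= 1.
Proof. exact: cos_le1. Qed.

Lemma maximizer_M_gt0 : 0 < M x.
Proof.
(* Equally spaced angles from [pi / n] to [pi]: they are distinct, and omitting 0 keeps every cosine
   below 1, so [M] is positive there. *)
pose phi (j : 'I_n) : R := j.+1%:R / n%:R * pi.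
have n0 (j : 'I_n) : 0 < n%:R :> R by rewrite ltr0n (leq_ltn_trans _ (ltn_ord j)).
have phi_in j : phi j \in `[0, pi].
  rewrite in_itv/= mulr_ge0 ?pi_ge0 ?divr_ge0//= ler_piMl ?pi_ge0//.
  by rewrite ler_pdivrMr ?(n0 j)// mul1r ler_nat.
apply: lt_le_trans (_ : M (fun j => cos (phi j)) <= _).
  apply/M_gt0P => //; split=> [j k /(cos_inj (phi_in j) (phi_in k))|j].
    move/(mulIf (lt0r_neq0 (pi_gt0 R)))/(divIf (lt0r_neq0 (n0 j))) => /eqP.
    by rewrite eqr_nat eqSS => /eqP/val_inj.
  rewrite -cos0 ltr_cos// ?in_itv/= ?lexx ?pi_ge0//.
  by rewrite !mulr_gt0 ?pi_gt0 ?invr_gt0 ?(n0 j).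
apply: theta_max.2; split=> [j|j k jk]; first by have := phi_in j; rewrite in_itv.
by rewrite ler_wpM2r ?pi_ge0// ler_wpM2r ?invr_ge0// ler_nat.
Qed.

Lemma maximizer_cos_inj : injective x.
Proof. exact: (elimT (M_gt0P (cos_le theta)) maximizer_M_gt0).1. Qed.

Lemma maximizer_cos_lt1 j : x j < 1.
Proof. exact: (elimT (M_gt0P (cos_le theta)) maximizer_M_gt0).2. Qed.

Lemma maximizer_gt0 j : 0 < theta j.
Proof.
have /andP[t0 _] := theta_max.1.1 j.
rewrite lt_neqAle t0 andbT; apply: contraTneq (maximizer_cos_lt1 j) => e.
by rewrite /x -e cos0 ltxx.
Qed.

Lemma maximizer_lt (j k : 'I_n) : (j < k)%N -> theta j < theta k.
Proof.
move=> jk; rewrite lt_neqAle theta_max.1.2 1?ltnW// andbT.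
apply: contraTneq jk => e; suff -> : j = k by rewrite ltnn.
by apply: maximizer_cos_inj; rewrite /x e.
Qed.

(** Moving [theta i] to a [t] between its neighbours preserves the order of the angles, so the new
    point competes with the maximizer. *)
Lemma maximizer_M2_section_le (i : 'I_n) (t : R) : 0 <= t <= pi ->
  (forall k : 'I_n, (k < i)%N -> theta k <= t) ->
  (forall k : 'I_n, (i < k)%N -> t <= theta k) ->
  (M2_section x i).[cos t] <= (M2_section x i).[x i].
Proof.
move=> t_in lt_t t_lt; pose phi := [eta theta with i |-> t].
have <- : cos (phi i) = cos t by rewrite /phi/= eqxx.
apply: (@M2_section_le _ _ x (fun j => cos (phi j))) => //.
- by move=> j; exact: cos_le1.
- by move=> k /negPf ki; rewrite /phi/= ki.
- exact: maximizer_M_gt0.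
apply: theta_max.2; rewrite /phi; split=> [j|j k jk] /=.
  by case: eqP => // _; exact: theta_max.1.1.
case: (eqVneq j i) => [ji|ji]; case: (eqVneq k i) => [ki|ki] //.
- by apply: t_lt; rewrite -ji ltn_neqAle jk andbT ji eq_sym -val_eqE in ki *.
- by apply: lt_t; rewrite -ki ltn_neqAle jk andbT ki -val_eqE in ji *.
- exact: theta_max.1.2.
Qed.

Lemma M2_section_prod_neq0 i :
  (\prod_(k < n | k != i) ('X - (x k)%:P)).[x i] != 0.
Proof.
rewrite horner_prod; apply/prodf_neq0 => k ki.
by rewrite !hornerE subr_eq0 (inj_eq maximizer_cos_inj) eq_sym.
Qed.

(** Otherwise the last angle could move to [pi]: the factor [1 - t] would strictly increase, and no
    distance to another cosine would shrink. *)
Lemma maximizer_last (i : 'I_n) : (forall k : 'I_n, (k <= i)%N) -> x i = -1.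
Proof.
move=> imax; apply/eqP; rewrite eq_le cos_geN1 andbT leNgt; apply/negP => xi.
have := @maximizer_M2_section_le i pi.
rewrite pi_ge0 lexx cospi => /(_ isT) H.
have {H} : (M2_section x i).[-1] <= (M2_section x i).[x i].
  apply: H => k; first by have /andP[] := theta_max.1.1 k.
  by rewrite ltnNge imax.
rewrite leNgt => /negP; apply; rewrite !hornerM2_section.
set q := \prod_(k < n | _) _.
have q2 : 0 < q.
  apply: prodr_gt0 => k ki.
  by rewrite exprn_even_gt0//= subr_eq0 (inj_eq maximizer_cos_inj) eq_sym.
apply: (@lt_le_trans _ _ ((1 - -1) * q)).
  by rewrite ltr_pM2r// ltrD2l ltrN2.
rewrite ler_wpM2l ?opprK ?addr_ge0//; apply: ler_prod => k ki; rewrite sqr_ge0/=.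
have : (k < i)%N by rewrite ltn_neqAle imax andbT.
move/maximizer_lt; rewrite -ltr_cos// -/(x k) -/(x i) => ik; rewrite -subr_ge0.
(* Both factors are nonnegative because [-1 <= x i < x k]. *)
have -> : (-1 - x k) ^+ 2 - (x i - x k) ^+ 2 =
    (x i - -1) * ((x k - -1) + (x k - x i)) by ring.
apply: mulr_ge0; first by rewrite subr_ge0; exact: cos_geN1.
by apply: addr_ge0; rewrite subr_ge0 ?(ltW ik)//; exact: cos_geN1.
Qed.

(** A later angle forces [theta i < pi], so [theta i] is an interior maximum of [t |-> h(cos t)],
    with [h] the section. The derivative there is [- sin (theta i)] times [h'(x i)], and the sine is
    nonzero. *)
Lemma M2_section_deriv_eq0 (i : 'I_n) : (exists k : 'I_n, (i < k)%N) ->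
  (M2_section x i)^`().[x i] = 0.
Proof.
move=> [k0 ik0].
have ti_pi : theta i < pi.
  by rewrite (lt_le_trans (maximizer_lt ik0))//; have /andP[] := theta_max.1.1 k0.
(* The open interval from [a] to [b] is the room left to [theta i] by the other angles; the defaults
   0 and [pi] also keep it inside the allowed range. *)
pose a := \big[Num.max/0]_(k < n | (k < i)%N) theta k.
pose b := \big[Num.min/pi]_(k < n | (i < k)%N) theta k.
have ai : a < theta i.
  by apply/bigmax_ltP; split=> [|k ki]; [exact: maximizer_gt0|exact: maximizer_lt].
have ib : theta i < b.
  by apply/bigmin_gtP; split=> // k ik; exact: maximizer_lt.
have Dh (t : R) : is_derive t 1 (horner (M2_section x i) \o cos)
    (- sin t * (M2_section x i)^`().[cos t]).
  by rewrite mulrC; apply: is_derive1_comp.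
have := @derive1_at_max _ (horner (M2_section x i) \o cos) a b (theta i).
move=> /(_ (ltW (lt_trans ai ib)) (fun t _ => @ex_derive _ _ _ _ _ _ _ (Dh t))).
rewrite in_itv/= ai ib => /(_ isT) H.
have {H} D0 : is_derive (theta i) 1 (horner (M2_section x i) \o cos) 0.
  apply: H => t; rewrite in_itv/= => /andP[/bigmax_ltP[t0 at_] /bigmin_gtP[tpi tb]].
  by apply: maximizer_M2_section_le => [|k /at_/ltW|k /tb/ltW]//; rewrite !ltW.
have := @derive_val _ _ _ _ _ _ _ (Dh (theta i)).
rewrite (@derive_val _ _ _ _ _ _ _ D0) => /esym/eqP.
by rewrite mulf_eq0 oppr_eq0 gt_eqF ?sin_gt0_pi ?maximizer_gt0//= => /eqP.
Qed.

(** With [p = (X - x i) q], at [x i] one has [p' = q] and [p'' = 2 q'], while the section has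
    derivative [q (2 (1 - x i) q' - q)]; the nonzero [q] cancels. *)
Lemma maximizer_critical (i : 'I_n) : (exists k : 'I_n, (i < k)%N) ->
  (1 - x i) * (p theta)^`()^`().[x i] = (p theta)^`().[x i].
Proof.
move=> /M2_section_deriv_eq0; have := M2_section_prod_neq0 i.
have -> : p theta = ('X - (x i)%:P) * \prod_(k < n | k != i) ('X - (x k)%:P).
  by rewrite /p (bigD1 i).
rewrite /M2_section; set q := \prod_(k < n | _) _ => q0.
rewrite !poly.derivE/= !hornerE /= => H.
have : q.[x i] * (2 * (1 - x i) * q^`().[x i] - q.[x i]) = 0 by rewrite -H; ring.
move=> /eqP; rewrite mulf_eq0 (negPf q0)/= => /eqP H'.
apply/eqP; rewrite -subr_eq0 -H'; apply/eqP; ring.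
Qed.

End maximizer.

(** * The polynomial differential equation *)

(** The differential operator multiplies the top coefficient, of degree [n], by
    [- n (n - 1) - n = - n ^ 2], which the added term cancels. *)
Lemma size_ode_defect (A : comNzRingType) (q : {poly A}) n : (size q <= n.+1)%N ->
  (size ((1 + 'X) * ((1 - 'X) * q^`()^`() - q^`()) + n%:R ^+ 2 *: q)%R <= n)%N.
Proof.
move=> /leq_sizeP q_big; apply/leq_sizeP => j nj.
have -> : (1 + 'X) * ((1 - 'X) * q^`()^`() - q^`()) =
    q^`()^`() - 'X^2 * q^`()^`() - q^`() - 'X * q^`() by ring.
rewrite coefD !coefB coefXnM coefXM coefZ !coef_deriv.
rewrite (q_big j.+1 nj) (q_big j.+2 (leqW nj)) !mul0rn.
(* For [j < 2] the uniform formula also gives 0, since [j] or [j.-1] is 0. *)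
have -> : (if (j < 2)%N then 0 else q`_(j - 2).+2 *+ (j - 2).+2 *+ (j - 2).+1) =
    q`_j *+ j *+ j.-1.
  by case: j {nj} => [|[|j]]//=; rewrite ?subn2.
have -> : (if j == 0%N then 0 else q`_j.-1.+1 *+ j.-1.+1) = q`_j *+ j by case: j {nj}.
have -> : 0 - q`_j *+ j *+ j.-1 - 0 - q`_j *+ j = - (q`_j *+ (j * j)).
  rewrite !sub0r subr0 -opprD -mulrnA -mulrnDr -mulnSr; congr (- (_ *+ _)).
  by case: j {nj}.
move: nj; rewrite leq_eqVlt => /orP[/eqP -> | nj].
  by rewrite -(mulr_natl q`_j) natrM expr2 addNr.
by rewrite q_big// mul0rn mulr0 oppr0 addr0.
Qed.

Lemma maximizer_poly_ode (R : realType) n (theta : 'I_n -> R) :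
  maximizes_M theta ->
  (1 + 'X) * ((1 - 'X) * (p theta)^`()^`() - (p theta)^`()) =
  - n%:R ^+ 2 *: p theta.
Proof.
move=> theta_max; apply/eqP; rewrite -subr_eq0; apply/eqP.
have sp : size (p theta) = n.+1.
  by rewrite /p size_prod_XsubC /index_enum -enumT size_enum_ord.
apply: (@roots_geq_poly_eq0 _ _ [seq cos (theta j) | j : 'I_n]); last 2 first.
- by rewrite map_inj_uniq ?enum_uniq//; exact: maximizer_cos_inj.
- by rewrite size_map size_enum_ord scaleNr opprK size_ode_defect// sp.
apply/allP => _ /mapP[i _ ->]; rewrite /root; apply/eqP.
have pi0 : (p theta).[cos (theta i)] = 0.
  by rewrite /p horner_prod (bigD1 i)//= hornerXsubC subrr mul0r.
rewrite !hornerE/= pi0 mulr0 subr0.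
(* If an index follows [i], the bracket vanishes by criticality; otherwise [cos (theta i) = -1] and
   the factor [1 + X] vanishes. *)
have [k ik|ki] := pickP (fun k : 'I_n => (i < k)%N).
  by rewrite (maximizer_critical theta_max) ?subrr ?mulr0//; exists k.
rewrite (maximizer_last theta_max) ?subrr ?mul0r// => k.
by rewrite leqNgt ki.
Qed.

(** * Derivatives of [f] and the final equation *)

Section ode.
Variables (R : realType) (n : nat) (theta : 'I_n -> R).

Definition df (x : R) : R :=
  Num.sqrt (1 - x) * (p theta)^`().[x] - (p theta).[x] / (2 * Num.sqrt (1 - x)).

Lemma is_derive_sqrt_onem (x : R) : x < 1 ->
  is_derive x 1 (fun y : R => Num.sqrt (1 - y)) (- (2 * Num.sqrt (1 - x))^-1).
Proof.
move=> x1; have := @is_derive1_sqrt R (1 - x); rewrite subr_gt0 => /(_ x1) ?.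
have -> : (fun y : R => Num.sqrt (1 - y)) = Num.sqrt \o (cst 1 - id) by [].
by apply: is_derive_eq; rewrite sub0r mulrN1.
Qed.

Lemma is_derive_f (x : R) : x < 1 -> is_derive x 1 (f theta) (df x).
Proof.
move=> x1; have Ds := is_derive_sqrt_onem x1.
have -> : f theta = (fun y : R => Num.sqrt (1 - y)) * horner (p theta) by [].
by apply: is_derive_eq; rewrite /df /GRing.scale/=; ring.
Qed.

Lemma is_derive_df (x : R) : x < 1 ->
  is_derive x 1 df (Num.sqrt (1 - x) * (p theta)^`()^`().[x]
    - (p theta)^`().[x] / Num.sqrt (1 - x)
    - (p theta).[x] / (4 * (1 - x) * Num.sqrt (1 - x))).
Proof.
move=> x1; have Ds := is_derive_sqrt_onem x1.
have s0 : Num.sqrt (1 - x) != 0 by rewrite gt_eqF// sqrtr_gt0 subr_gt0.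
have x0 : 1 - x != 0 by rewrite gt_eqF// subr_gt0.
have s2 : Num.sqrt (1 - x) ^+ 2 = 1 - x by rewrite sqr_sqrtr// subr_ge0 ltW.
pose s : R -> R := fun y => Num.sqrt (1 - y); pose sV : R -> R := fun y => (s y)^-1.
have DsV : is_derive x 1 sV (- s x ^- 2 *: (- (2 * s x)^-1)) by exact: is_deriveV.
(* This form exposes [df] to the sum, product and scaling rules for [is_derive]. *)
have -> : df = s * horner (p theta)^`() - 2^-1 \*: (horner (p theta) * sV).
  by apply/funext => y; rewrite /df invfM mulrCA.
apply: is_derive_eq; rewrite /GRing.scale/= /sV /s.
move: s0 s2; set r := Num.sqrt _ => r0 r2; rewrite -r2.
by field.
Qed.

End ode.

Theorem theorem5p2 (R : realType) (n : nat) (theta : 'I_n -> R) :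
  (1 <= n)%N ->
  maximizes_M theta ->
  forall x : R, -1 < x < 1 ->
    [/\ derivable (f theta) x 1,
        derivable (derive1 (f theta)) x 1
      & derive1n 2 (f theta) x =
          (- n%:R ^+ 2) / (1 - x ^+ 2) *
          ((1 - x + 1 / (4 * n%:R ^+ 2) * (1 + x)) / (1 - x)) *
          f theta x].
Proof.
move=> n1 theta_max x /andP[xN1 x1].
have Df (y : R) : y < 1 -> (f theta)^`()%classic y = df theta y.
  by move=> y1; rewrite derive1E; apply: derive_val; exact: is_derive_f.
have Ddf := is_derive_df theta x1.
have D2f : is_derive x 1 (f theta)^`()%classic
   (Num.sqrt (1 - x) * (p theta)^`()^`().[x]
    - (p theta)^`().[x] / Num.sqrt (1 - x)
    - (p theta).[x] / (4 * (1 - x) * Num.sqrt (1 - x))).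
  (* [f'] agrees with [df] only below 1, but this covers a neighbourhood of [x], which suffices to
     transfer the derivative. *)
  apply: near_eq_is_derive Ddf.
  by near=> y; rewrite Df//; near: y; exact: lt_nbhsl.
split; [by case: (is_derive_f theta x1) | by case: D2f |].
rewrite derive1nS/= derive1E (@derive_val _ _ _ _ _ _ _ D2f).
have s0 : Num.sqrt (1 - x) != 0 by rewrite gt_eqF// sqrtr_gt0 subr_gt0.
have n0 : n%:R != 0 :> R by rewrite pnatr_eq0 -lt0n.
have x0 : 1 + x != 0 by rewrite gt_eqF// -ltrBlDl sub0r.
have s2 : Num.sqrt (1 - x) ^+ 2 = 1 - x by rewrite sqr_sqrtr// subr_ge0 ltW.
have := congr1 (horner^~ x) (maximizer_poly_ode theta_max).
rewrite !hornerE/= /f => ode.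
(* With [s = sqrt (1 - x)], both sides of the goal contain [- p / (4 s ^ 3)]; what remains is the
   polynomial equation divided by [(1 + x) s]. Solving it for [p(x)] lets [field] conclude. *)
have {}ode : (p theta).[x] =
    (1 + x) * ((1 - x) * (p theta)^`()^`().[x] - (p theta)^`().[x]) / (- n%:R ^+ 2).
  by rewrite ode mulrAC divff ?mul1r// oppr_eq0 expf_neq0.
have -> : 1 - x ^+ 2 = (1 - x) * (1 + x) by ring.
move: s2 s0; set s := Num.sqrt _ => s2 s0.
rewrite ode -s2.
by field; rewrite n0 s0.
Unshelve. all: by end_near. Qed.
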